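(* Let $\mathbf{E}_J$ be a $W$-graph ideal with respect to $J\subseteq S$ and $L$, with module $M=M(\mathbf{E}_J,L)$, let $\hat M=\mathrm{Hom}_A(M,A)$, and let $\{D_z\mid z\in\mathbf{E}_J\}$ be the $A$-basis of $\hat M$ defined by $D_z(\mathbf{C}_w)=\delta_{z,w}$ for all $w\in\mathbf{E}_J$. Let $s\in S$ and assume that $L(s)>0$. The basis elements $\{D_z\mid z\in\mathbf{E}_J\}$ give $\hat M$ the structure of a $W$-graph module such that $$T_sD_z=\begin{cases}-q^{-L(s)}D_z+D_{sz}+\sum_{z<u,\ s\in A(u)}m^s_{z,u}D_u & \text{if } s\in SD(z),\\ q^{L(s)}D_z & \text{if } s\in A(z),\\ -q^{-L(s)}D_z+\sum_{z<u,\ s\in A(u)}m^s_{z,u}D_u & \text{if } s\in WD(z),\end{cases}$$ where the sums are over $u\in\mathbf{E}_J$.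
   Context: Let $(W,S)$ be a Coxeter system with length function $\ell$ and Bruhat order $\leqslant$. Let $\Gamma$ be a totally ordered abelian group (written additively) and $L:W\to\Gamma$ a weight function: elements $L(s)\in\Gamma$ ($s\in S$) are given with $L(s)=L(t)$ whenever $s,t$ are conjugate in $W$, and $L(w)=L(s_1)+\dots+L(s_k)$ for a reduced expression $w=s_1\cdots s_k$. Assume $L(s)\geqslant 0$ for all $s\in S$. Let $R\subseteq\mathbb C$ be a subring and $A=R[\Gamma]$ the group algebra, with $R$-basis $\{q^\gamma\mid\gamma\in\Gamma\}$, $q^\gamma q^{\gamma'}=q^{\gamma+\gamma'}$. $A_{\geqslant0}$, $A_{>0}=R[\Gamma_{>0}]$ are the sets of $R$-linear combinations of $q^\gamma$ with $\gamma\geqslant 0$, $\gamma>0$; the constant term is the coefficient of $q^0$. The ring involution $a\mapsto\overline a$ of $A$ is the $R$-linear map with $\overline{q^\gamma}=q^{-\gamma}$. $\mathcal H$ is the Hecke algebra over $A$ with basis $\{T_w\mid w\in W\}$ and $T_sT_w=T_{sw}$ if $\ell(sw)>\ell(w)$, $T_sT_w=T_{sw}+(q^{L(s)}-q^{-L(s)})T_w$ if $\ell(sw)<\ell(w)$. It has the ring involution $\overline{\sum a_wT_w}=\sum\overline{a_w}\,T_{w^{-1}}^{-1}$. A $W$-graph for $\mathcal H$ consists of: (a) a base set $\Lambda$ with a map $I$ assigning to each $x\in\Lambda$ a subset $I(x)\subseteq S$; (b) for each $s\in S$ with $L(s)>0$, a collection of elements $\mu^s_{x,y}\in A$ for $x,y\in\Lambda$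 with $s\in I(x)$, $s\notin I(y)$; (c) for each $s\in S$ with $L(s)=0$, a bijection $\Lambda\to\Lambda$, $x\mapsto s.x$. It is required that $q^{L(s)}\mu^s_{x,y}\in R[\Gamma_{>0}]$ and $\overline{\mu^s_{x,y}}=\mu^s_{x,y}$ whenever defined, and that, on the free $A$-module with basis $\{b_y\mid y\in\Lambda\}$, the assignment $T_s\mapsto\rho_s$ defines a representation of $\mathcal H$, where $\rho_s(b_y)=b_{s.y}$ if $L(s)=0$; $\rho_s(b_y)=-q^{-L(s)}b_y$ if $L(s)>0$, $s\in I(y)$; $\rho_s(b_y)=q^{L(s)}b_y+\sum_{x\in\Lambda,\,s\in I(x)}\mu^s_{x,y}b_x$ if $L(s)>0$, $s\notin I(y)$. For $J\subseteq S$ let $D_J=\{w\in W\mid\ell(ws)>\ell(w)\text{ for all }s\in J\}$. The left weak order: $x\leqslant_L y$ iff $y=zx$ with $\ell(y)=\ell(z)+\ell(x)$. Let $\mathbf{E}_J$ be a (nonempty) ideal, i.e. down-closed subset, of $(W,\leqslant_L)$ with $\mathbf{E}_J\subseteq D_J$. For $s\in S$ put $\mathbf{E}_{J,s}^-=\{w\in\mathbf{E}_J\mid\ell(sw)<\ell(w),\ sw\in\mathbf{E}_J\}$, $\mathbf{E}_{J,s}^+=\{w\in\mathbf{E}_J\mid\ell(sw)>\ell(w),\ sw\in\mathbf{E}_J\}$, $\mathbf{E}_{J,s}^{0,-}=\{w\in\mathbf{E}_J\mid\ell(sw)>\ell(w),\ sw\notin D_J\}$, $\mathbf{E}_{J,s}^{0,+}=\{w\in\mathbf{E}_J\mid\ell(sw)>\ell(w),\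 sw\in D_J\setminus\mathbf{E}_J\}$. For $w\in\mathbf{E}_J$: $SD(w)$, $SA(w)$, $WD(w)$, $WA(w)$ are the sets of $s\in S$ with $w\in\mathbf{E}_{J,s}^-$, $\mathbf{E}_{J,s}^+$, $\mathbf{E}_{J,s}^{0,-}$, $\mathbf{E}_{J,s}^{0,+}$ respectively; $D(w)=SD(w)\cup WD(w)$ and $A(w)=SA(w)\cup WA(w)$. $\mathbf{E}_J$ is a $W$-graph ideal with respect to $J$ and $L$ if: (i) there is an $A$-free $\mathcal H$-module $M(\mathbf{E}_J,L)$ with $A$-basis $\{\Gamma_w\mid w\in\mathbf{E}_J\}$ such that for all $s\in S$, $w\in\mathbf{E}_J$: $T_s\Gamma_w=\Gamma_{sw}+(q^{L(s)}-q^{-L(s)})\Gamma_w$ if $w\in\mathbf{E}_{J,s}^-$; $T_s\Gamma_w=\Gamma_{sw}$ if $w\in\mathbf{E}_{J,s}^+$; $T_s\Gamma_w=-q^{-L(s)}\Gamma_w$ if $w\in\mathbf{E}_{J,s}^{0,-}$; $T_s\Gamma_w=q^{L(s)}\Gamma_w-\sum_{z\in\mathbf{E}_J,\,z<w}r^s_{z,w}\Gamma_z$ if $w\in\mathbf{E}_{J,s}^{0,+}$, for some $r^s_{z,w}\in q^{L(s)}A_{>0}$; (ii) $M(\mathbf{E}_J,L)$ admits an $A$-semilinear involution $\alpha\mapsto\overline\alpha$ with $\overline{\Gamma_1}=\Gamma_1$ and $\overline{h\alpha}=\overline h\,\overline\alpha$ for all $h\in\mathcal H$, $\alpha\in M(\mathbf{E}_J,L)$.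 Recalled from earlier work: for $w\in\mathbf{E}_J$, $\mathbf{C}_w=\sum_{y\in\mathbf{E}_J}P_{y,w}\Gamma_y$ is the unique element of $M$ with $\overline{\mathbf{C}_w}=\mathbf{C}_w$, $P_{y,w}\in A_{\geqslant0}$, $P_{y,w}=0$ if $y\not\leqslant w$, $P_{w,w}=1$, and $P_{y,w}$ with zero constant term if $y\ne w$; these form an $A$-basis of $M$. They give $M$ the structure of a $W$-graph module, and the elements $m^s_{z,v}\in A$ are the coefficients in $T_s\mathbf{C}_v=q^{L(s)}\mathbf{C}_v+\mathbf{C}_{sv}+\sum_{z<v,\,s\in D(z)}m^s_{z,v}\mathbf{C}_z$ if $s\in SA(v)$; $T_s\mathbf{C}_v=-q^{-L(s)}\mathbf{C}_v$ if $s\in D(v)$; $T_s\mathbf{C}_v=q^{L(s)}\mathbf{C}_v+\sum_{z<v,\,s\in D(z)}m^s_{z,v}\mathbf{C}_z$ if $s\in WA(v)$ (sums over $z\in\mathbf{E}_J$). On $\hat M=\mathrm{Hom}_A(M,A)$ the left $\mathcal H$-module structure is defined by $(hf)(m)=f(hm)$ for $f\in\hat M$, $m\in M$, $h\in\mathcal H$.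
   Formalization: W-graph is meant with q^{L(s)} and -q^{-L(s)} exchanged and I(z)=A(z) (false as displayed); (hf)(m)=f(hm) is imposed only for h=T_s; the W-graph claim presumes {D_z} is a basis (E_J finite) and that T_s permutes the C_w when L(s)=0. *)

(* Defs.v *)
From HB Require Import structures.
From mathcomp Require Import all_boot all_order all_algebra.
From mathcomp Require Import complex.
From mathcomp Require Import all_classical reals.

Set Implicit Arguments.
Unset Strict Implicit.
Unset Printing Implicit Defensive.

Import Order.TTheory GRing.Theory Num.Theory.
Local Open Scope classical_set_scope.
Local Open Scope ring_scope.

Section Basis.
Context (K : nzRingType) (V : lmodType K) (I : choiceType).
Implicit Types (X : set I) (b : I -> V) (v : V) (c : I -> K).

(* The values of b outside X are irrelevant. *)
Definition is_coord X b v c :=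
  [/\ finite_set [set i | c i != 0], [set i | c i != 0] `<=` X &
      v = \sum_(i \in X) c i *: b i].

Definition is_basis X b := forall v, exists! c, is_coord X b v c.

(* Only meaningful when [is_basis X b]. *)
Definition coord X b v : I -> K := xget (fun=> 0) (is_coord X b v).

End Basis.

Definition totally_ordered_group (G : porderZmodType) :=
  (forall x y : G, (x <= y) || (y <= x)) /\
  (forall x y z : G, x <= y -> x + z <= y + z).

Section GroupAlgebra.
Context (R : comNzRingType) (G : porderZmodType) (A : comAlgType R).
Variable q : G -> A.

(* A with its basis q is the group algebra R[G]; multinomials' monalg is not
   applicable, since its monoids of exponents have no nontrivial units. *)
Definition is_group_algebra :=
  [/\ is_basis setT q, q 0 = 1 & forall g h, q (g + h) = q g * q h].

Definition qcoef (a : A) (g : G) : R := coord setT q a g.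

Definition A_ge0 : set A := [set a | forall g, qcoef a g != 0 -> 0 <= g].
Definition A_gt0 : set A := [set a | forall g, qcoef a g != 0 -> 0 < g].

Definition qbar (a : A) : A := \sum_(g \in setT) qcoef a g *: q (- g).

End GroupAlgebra.

Section Coxeter.
Context (W : groupType) (S : set W).
Local Open Scope group_scope.

Definition is_word (u : seq W) (w : W) :=
  (forall x, x \in u -> S x) /\ foldr (fun x y => x * y) 1 u = w.

(* Coxeter system: W is presented by the generating set S of involutions and
   the relations (s t)^n = 1 that hold in W. *)
Definition Coxeter_system :=
  [/\ forall w, exists u, is_word u w,
      forall s, S s -> s != 1 /\ s * s = 1 &
      forall (G : groupType) (f : W -> G),
        (forall s t n, S s -> S t -> (s * t) ^+ n = 1 ->
           (f s * f t) ^+ n = 1) ->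
        exists2 phi : W -> G, {morph phi : x y / x * y} &
          forall s, S s -> phi s = f s].

Definition has_word_of_size w n := `[< exists2 u, is_word u w & size u = n >].

(* When S does not generate W, words may not exist and the junk value is 0. *)
Definition len (w : W) : nat :=
  if pselect (exists n, has_word_of_size w n) is left h then ex_minn h else 0%N.

Definition reduced (u : seq W) (w : W) := is_word u w /\ size u = len w.

Definition conjugate (x y : W) := exists g, y = g * x * g^-1.

Definition reflection (t : W) := exists2 s, S s & conjugate s t.

Inductive Bruhat_le (y : W) : W -> Prop :=
| Bruhat_refl : Bruhat_le y y
| Bruhat_step x t : Bruhat_le y x -> reflection t -> (len x < len (t * x))%N ->
    Bruhat_le y (t * x).

Definition Bruhat_lt y w := Bruhat_le y w /\ y <> w.

Definition weak_le (x y : W) :=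
  exists2 z, y = z * x & len y = (len z + len x)%N.

Definition weight_function (G : porderZmodType) (L : W -> G) :=
  (forall s t, S s -> S t -> conjugate s t -> L s = L t) /\
  (forall u w, reduced u w -> L w = \sum_(x <- u) L x)%R.

Definition D_ (J : set W) : set W :=
  [set w | forall s, J s -> (len w < len (w * s))%N].

Variables J E : set W.

Definition ideal_in_D :=
  [/\ E !=set0, E `<=` D_ J & forall x y, E y -> weak_le x y -> E x].

Definition SD (w : W) : set W :=
  [set s | [/\ S s, E w, (len (s * w) < len w)%N & E (s * w)]].
Definition SA (w : W) : set W :=
  [set s | [/\ S s, E w, (len w < len (s * w))%N & E (s * w)]].
Definition WD (w : W) : set W :=
  [set s | [/\ S s, E w, (len w < len (s * w))%N & ~ D_ J (s * w)]].
Definition WA (w : W) : set W :=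
  [set s | [/\ S s, E w, (len w < len (s * w))%N,
               D_ J (s * w) & ~ E (s * w)]].
Definition Des (w : W) : set W := SD w `|` WD w.
Definition Asc (w : W) : set W := SA w `|` WA w.

End Coxeter.

Section Hecke.
Context (R : comNzRingType) (G : porderZmodType) (A : comAlgType R).
Variable q : G -> A.
Context (W : groupType) (S : set W) (L : W -> G).
Context (H : unitAlgType A) (T : W -> H).

Definition is_Hecke_algebra :=
  [/\ is_basis setT T, T 1%g = 1,
      forall s w, S s -> (len S w < len S (s * w)%g)%N ->
        T s * T w = T (s * w)%g &
      forall s w, S s -> (len S (s * w)%g < len S w)%N ->
        T s * T w = T (s * w)%g + (q (L s) - q (- L s)) *: T w].

Definition Hbar (h : H) : H :=
  \sum_(w \in setT) qbar q (coord setT T h w) *: (T (w^-1)%g)^-1.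

Definition is_Hmodule (V : lmodType A) (act : H -> {linear V -> V}) :=
  [/\ forall a h k v, act (a *: h + k) v = a *: act h v + act k v,
      forall v, act 1 v = v &
      forall h k v, act (h * k) v = act h (act k v)].

(* W-graphs come in two mirror conventions, exchanged by the algebra
   automorphism fixing T_s if L s = 0 and sending T_s to - T_s^-1 otherwise
   (which also changes the sign of mu). In the direct one, T_s acts on b_y as
   - q^(- L s) if s \in I y, and as q^(L s) plus a sum over {x | s \in I x}
   otherwise; in the mirror one, the scalars q^(L s) and - q^(- L s) are
   exchanged. Transposing a direct W-graph produces a mirror one: already for
   W = {1, s}, J = set0, E = W and L s > 0, the dual of the Kazhdan-Lusztig
   basis satisfies T_s D_s = - q^(- L s) D_s + D_1 and T_s D_1 = q^(L s) D_1,
   which is not of the direct form for any I. *)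
Variant convention := Direct | Mirror.

Definition desc_scalar (cv : convention) (s : W) : A :=
  if cv is Direct then - q (- L s) else q (L s).
Definition asc_scalar (cv : convention) (s : W) : A :=
  if cv is Direct then q (L s) else - q (- L s).

(* tau s is the operator by which T_s acts on V. *)
Record is_Wgraph_module (cv : convention) (V : lmodType A) (tau : W -> V -> V)
    (I : choiceType) (X : set I) (b : I -> V) (Iset : I -> set W)
    (mu : W -> I -> I -> A) (perm : W -> I -> I) : Prop := {
  Wgraph_basis : is_basis X b;
  Wgraph_desc : forall x, X x -> Iset x `<=` S;
  Wgraph_mu : forall s x y, S s -> 0 < L s -> X x -> X y ->
    Iset x s -> ~ Iset y s ->
    A_gt0 q (q (L s) * mu s x y) /\ qbar q (mu s x y) = mu s x y;
  Wgraph_finite : forall s y, S s -> 0 < L s -> X y -> ~ Iset y s ->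
    finite_set [set x | [/\ X x, Iset x s & mu s x y != 0]];
  Wgraph_perm : forall s, S s -> L s = 0 -> set_bij X X (perm s);
  Wgraph_rep : exists rho : H -> {linear V -> V},
    is_Hmodule rho /\ forall s v, S s -> rho (T s) v = tau s v;
  Wgraph_zero : forall s y, S s -> L s = 0 -> X y ->
    tau s (b y) = b (perm s y);
  Wgraph_descE : forall s y, S s -> 0 < L s -> X y -> Iset y s ->
    tau s (b y) = desc_scalar cv s *: b y;
  Wgraph_ascE : forall s y, S s -> 0 < L s -> X y -> ~ Iset y s ->
    tau s (b y) = asc_scalar cv s *: b y +
      \sum_(x \in [set x | X x /\ Iset x s]) mu s x y *: b x
}.

Variables J E : set W.
Context (M : lmodType A).
Variable act : H -> {linear M -> M}.

Record is_Wgraph_ideal (Gam : W -> M) (barM : M -> M) : Prop := {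
  ideal_sub : J `<=` S;
  ideal_ideal : ideal_in_D S J E;
  ideal_Hmodule : is_Hmodule act;
  ideal_basis : is_basis E Gam;
  ideal_SD : forall s w, SD S E w s ->
    act (T s) (Gam w) = Gam (s * w)%g + (q (L s) - q (- L s)) *: Gam w;
  ideal_SA : forall s w, SA S E w s -> act (T s) (Gam w) = Gam (s * w)%g;
  ideal_WD : forall s w, WD S J E w s ->
    act (T s) (Gam w) = - q (- L s) *: Gam w;
  ideal_WA : forall s w, WA S J E w s -> exists2 r : W -> A,
    (forall z, E z -> Bruhat_lt S z w ->
       exists2 a, A_gt0 q a & r z = q (L s) * a) &
    act (T s) (Gam w) = q (L s) *: Gam w -
      \sum_(z \in [set z | E z /\ Bruhat_lt S z w]) r z *: Gam z;
  ideal_bar_semilinear : forall a x y,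
    barM (a *: x + y) = qbar q a *: barM x + barM y;
  ideal_barK : involutive barM;
  ideal_bar1 : barM (Gam 1%g) = Gam 1%g;
  ideal_bar_act : forall h x, barM (act h x) = act (Hbar h) (barM x)
}.

Record is_KL_basis (Gam : W -> M) (barM : M -> M) (C : W -> M) : Prop := {
  KL_bar : forall w, E w -> barM (C w) = C w;
  KL_ge0 : forall y w, E y -> E w -> A_ge0 q (coord E Gam (C w) y);
  KL_supp : forall y w, E y -> E w -> ~ Bruhat_le S y w ->
    coord E Gam (C w) y = 0;
  KL_diag : forall w, E w -> coord E Gam (C w) w = 1;
  KL_const : forall y w, E y -> E w -> y <> w ->
    qcoef q (coord E Gam (C w) y) 0 = 0
}.

(* m s z v stands for m^s_{z,v}, which is relevant only if L s > 0, z < v,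
   s \in Des z and s \in Asc v. Lower Bruhat intervals are finite, so that
   the finiteness clause is no restriction; it rules out the conventional value
   0 of a sum of infinite support. *)
Record are_W_graph_coefs (C : W -> M) (m : W -> W -> W -> A) : Prop := {
  coefs_finite : forall s v, S s -> 0 < L s -> Asc S J E v s ->
    finite_set [set z | [/\ E z, Bruhat_lt S z v, Des S J E z s
                          & m s z v != 0]];
  coefs_SA : forall s v, 0 < L s -> SA S E v s ->
    act (T s) (C v) = q (L s) *: C v + C (s * v)%g +
      \sum_(z \in [set z | [/\ E z, Bruhat_lt S z v & Des S J E z s]])
        m s z v *: C z;
  coefs_D : forall s v, 0 < L s -> Des S J E v s ->
    act (T s) (C v) = - q (- L s) *: C v;
  coefs_WA : forall s v, 0 < L s -> WA S J E v s ->
    act (T s) (C v) = q (L s) *: C v +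
      \sum_(z \in [set z | [/\ E z, Bruhat_lt S z v & Des S J E z s]])
        m s z v *: C z
}.

(* The zero-weight part of the W-graph structure carried by the basis C. It can
   fail if L s = 0 for some s in J, since then T_s (C 1) = - C 1. *)
Definition zero_weight_perm (C : W -> M) (perm : W -> W -> W) :=
  forall s, S s -> L s = 0 ->
    set_bij E E (perm s) /\
    forall w, E w -> act (T s) (C w) = C (perm s w).

(* The coefficient of D_u in T_s D_z, for u <> z. *)
Definition dual_mu (m : W -> W -> W -> A) (s u z : W) : A :=
  if u == (s * z)%g then 1 else if `[< Bruhat_lt S z u >] then m s z u else 0.

End Hecke.

Section Dual.
Context (A : comNzRingType) (M : lmodType A).

Definition dual := {linear M -> A^o}.

HB.instance Definition _ := gen_eqMixin dual.
HB.instance Definition _ := gen_choiceMixin dual.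

Lemma dual_ext (f g : dual) : f =1 g -> f = g.
Proof.
case: f g => [f [[fN] [fZ]]] [g [[gN] [gZ]]] /= /funext fg.
by case: g / fg gN gZ => gN gZ; rewrite (Prop_irrelevance fN gN)
  (Prop_irrelevance fZ gZ).
Qed.

Definition dual_zero : dual := \0%R.
Definition dual_opp (f : dual) : dual := GRing.opp_fun f.
Definition dual_add (f g : dual) : dual := GRing.add_fun f g.
Definition dual_scale (a : A) (f : dual) : dual := GRing.scale_fun a f.

Lemma dual_addA : associative dual_add.
Proof. by move=> f g h; apply: dual_ext => x /=; rewrite addrA. Qed.

Lemma dual_addC : commutative dual_add.
Proof. by move=> f g; apply: dual_ext => x /=; rewrite addrC. Qed.

Lemma dual_add0 : left_id dual_zero dual_add.
Proof. by move=> f; apply: dual_ext => x /=; rewrite add0r. Qed.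

Lemma dual_addN : left_inverse dual_zero dual_opp dual_add.
Proof. by move=> f; apply: dual_ext => x /=; rewrite addNr. Qed.

HB.instance Definition _ :=
  GRing.isZmodule.Build dual dual_addA dual_addC dual_add0 dual_addN.

Lemma dual_scaleA a b (f : dual) :
  dual_scale a (dual_scale b f) = dual_scale (a * b) f.
Proof. by apply: dual_ext => x /=; rewrite scalerA. Qed.

Lemma dual_scale1 : left_id 1 dual_scale.
Proof. by move=> f; apply: dual_ext => x /=; rewrite scale1r. Qed.

Lemma dual_scaleDr : right_distributive dual_scale +%R.
Proof. by move=> a f g; apply: dual_ext => x /=; rewrite scalerDr. Qed.

Lemma dual_scaleDl (f : dual) :
  {morph dual_scale^~ f : a b / a + b}.
Proof. by move=> a b; apply: dual_ext => x /=; rewrite scalerDl. Qed.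

HB.instance Definition _ := GRing.Zmodule_isLmodule.Build A dual
  dual_scaleA dual_scale1 dual_scaleDr dual_scaleDl.

End Dual.

(* (h f)(x) = f(h x). For h = T_s these operators define a left H-module
   structure; for general h the formula reverses products, h being replaced in
   that structure by its image under the anti-automorphism
   T_w |-> T_(w^-1). *)
Definition dual_act (A : comNzRingType) (H : Type) (M : lmodType A)
    (act : H -> {linear M -> M}) (h : H) (f : dual M) : dual M :=
  f \o act h.

(* Main.v *)
Require Import Defs.
From HB Require Import structures.
From mathcomp Require Import all_boot all_order all_algebra.
From mathcomp Require Import perm complex finmap.
From mathcomp Require Import all_classical reals.

Set Implicit Arguments.
Unset Strict Implicit.
Unset Printing Implicit Defensive.

Import Order.TTheory GRing.Theory Num.Theory.
Local Open Scope classical_set_scope.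
Local Open Scope ring_scope.

(** The matrix of T_s on the dual basis D is the transpose of its matrix on the
    basis C: the coefficient of D_u in T_s D_z is D_z (T_s C_u).  The set E is
    split by s into ascents and descents [Asc_or_Des, Asc_notDes], and on C the
    operator T_s is triangular for this splitting, with scalars - q^(- L s) on
    descents and q^(L s) on ascents.  Transposing keeps these scalars and moves
    the other terms from the ascents to the descents; the term C_(s v) in
    T_s C_v becomes the term D_(s z) in T_s D_z because v |-> s v matches the
    strong ascents with the strong descents.  An identity
    between functionals is checked on C, which spans M because it is
    unitriangular with respect to the basis Gam [KL_ind].

    For the W-graph structure, three points go beyond transposing.

    - The operators T_s on the dual come from an H-module structure: h acts by
      the transpose of the action of flip h, where flip is the
      anti-automorphism T_w |-> T_(w^-1) of H [flipM].

    - The edge weights are bar-invariant and lie in q^(- L s) A_(>0).  For an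
      ascent s of v let X = T_s C_v - q^(L s) C_v.  Its coordinates on C are the
      weights out of v, the weight 1 at s v included.  X is fixed by the bar
      involution, since C_v is and bar (T_s) = T_s - (q^(L s) - q^(- L s)); so
      are its coordinates on the bar-invariant elements C_z [dual_mu_bar].  The
      Gam-coordinates of X at those z that have s as a descent are in
      q^(- L s) A_(>0), as one reads off the action of T_s on Gam
      [coord_Tdev_KL], and the passage from
      Gam to C, unitriangular with entries in A_(>=0), keeps this property
      [dual_mu_gt0].

    - If L s = 0, then T_s is an involution, so that the permutation by which it
      acts on C is its own inverse and is also the one for D [perm_dual]. *)

Local Notation coord := Defs.coord.

(** * Sums of finite support *)
Section FiniteSums.
Context (I : choiceType) (V : nmodType).
Implicit Types (X Y : set I) (F : I -> V).

(** A sum over X is a sum over an ordinary finite sequence as soon as some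
    finite Y contains the support.  Leaving Y free lets several families share
    one bound. *)
Lemma fsum_finite X Y F :
  finite_set Y -> (forall i, X i -> ~ Y i -> F i = 0) ->
  \sum_(i \in X) F i = \sum_(i <- fset_set (X `&` Y)) F i.
Proof.
move=> finY F0; rewrite -(@fsbig_widen _ _ _ _ (X `&` Y)).
- by rewrite fsbig_finite//; apply: finite_setIr.
- by move=> i [].
- by move=> i [Xi nXY]; apply: F0 => // Yi; apply: nXY.
Qed.

Lemma fsum_delta X F j :
  X j -> (forall i, X i -> i <> j -> F i = 0) -> \sum_(i \in X) F i = F j.
Proof.
move=> Xj F0; rewrite -(@fsbig_widen _ _ _ _ [set j]).
- exact: fsbig_set1.
- by move=> i ->.
- by move=> i [Xi nij]; apply: F0.
Qed.

Lemma fsumD X Y F F' :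
  finite_set Y -> (forall i, X i -> ~ Y i -> F i = 0) ->
  (forall i, X i -> ~ Y i -> F' i = 0) ->
  \sum_(i \in X) (F i + F' i) = \sum_(i \in X) F i + \sum_(i \in X) F' i.
Proof.
move=> finY F0 F'0; rewrite !(fsum_finite finY)// ?big_split//.
by move=> i Xi nYi; rewrite F0 ?F'0 ?addr0.
Qed.

End FiniteSums.

Lemma fsum_morph (I : choiceType) (V V' : nmodType) (g : V -> V')
    (X Y : set I) (F : I -> V) :
  g 0 = 0 -> {morph g : x y / x + y} ->
  finite_set Y -> (forall i, X i -> ~ Y i -> F i = 0) ->
  g (\sum_(i \in X) F i) = \sum_(i \in X) g (F i).
Proof.
move=> g0 gD finY F0; rewrite !(fsum_finite finY)//.
  exact: (big_morph g gD g0).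
by move=> i Xi nYi; rewrite F0.
Qed.

(** A sum of infinite support is 0 by convention: this case is covered by Z 0. *)
Lemma fsum_closed (I : choiceType) (V : nmodType) (Z : V -> Prop)
    (X : set I) (F : I -> V) :
  Z 0 -> (forall x y, Z x -> Z y -> Z (x + y)) ->
  (forall i, X i -> Z (F i)) -> Z (\sum_(i \in X) F i).
Proof.
move=> Z0 ZD ZF; case: finite_supportP => [_|Y YX _ _].
  by rewrite big_nil.
rewrite big_seq; apply: (big_ind Z) => // i iY; exact/ZF/YX.
Qed.

Lemma fsum_lin (K : nzRingType) (V : lmodType K) (I : choiceType)
    (X Y Y' : set I) (F F' : I -> V) (a : K) :
  finite_set Y -> (forall i, X i -> ~ Y i -> F i = 0) ->
  finite_set Y' -> (forall i, X i -> ~ Y' i -> F' i = 0) ->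
  \sum_(i \in X) (a *: F i + F' i)
    = a *: \sum_(i \in X) F i + \sum_(i \in X) F' i.
Proof.
move=> finY F0 finY' F'0.
have out i : X i -> ~ (Y `|` Y') i -> F i = 0 /\ F' i = 0.
  move=> Xi nY; split; [apply: F0|apply: F'0] => // Yi; apply: nY.
    by left.
  by right.
rewrite (@fsumD _ _ _ (Y `|` Y')).
- congr (_ + _); symmetry; apply: (fsum_morph _ _ finY F0).
    exact: scaler0.
  exact: scalerDr.
- by rewrite finite_setU.
- by move=> i Xi /(out _ Xi)[-> _]; rewrite scaler0.
- by move=> i Xi /(out _ Xi)[_ ->].
Qed.

Lemma dual_sumE (A : comNzRingType) (M : lmodType A) (I : choiceType)
    (X Y : set I) (F : I -> dual M) x :
  finite_set Y -> (forall i, X i -> ~ Y i -> F i = 0) ->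
  (\sum_(i \in X) F i) x = \sum_(i \in X) F i x.
Proof.
by move=> fY F0; apply: (@fsum_morph _ _ _ (fun f : dual M => f x) _ Y).
Qed.

(** * Coordinates in a basis *)
Section Bases.
Context (K : nzRingType) (V : lmodType K) (I : choiceType).
Context (X : set I) (b : I -> V) (hb : is_basis X b).

Lemma coordP v : is_coord X b v (coord X b v).
Proof. by have [c [cv _]] := hb v; apply: xgetPex; exists c. Qed.

Lemma coord_uniq v c : is_coord X b v c -> coord X b v = c.
Proof.
by move=> cv; have [d [_ du]] := hb v; rewrite -(du _ (coordP v)) (du _ cv).
Qed.

Lemma coord_finite v : finite_set [set i | coord X b v i != 0].
Proof. by case: (coordP v). Qed.

Lemma coord_out v i : ~ X i -> coord X b v i = 0.
Proof.
by move=> nX; have [_ s _] := coordP v; apply/eqP/negPn/negP => /s/nX.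
Qed.

Lemma coord_off v i : ~ [set i | coord X b v i != 0] i -> coord X b v i = 0.
Proof. by move=> /negP/negPn/eqP. Qed.

Lemma coord_sum v : v = \sum_(i \in X) coord X b v i *: b i.
Proof. by case: (coordP v). Qed.

Lemma coord_lin a u v i :
  coord X b (a *: u + v) i = a * coord X b u i + coord X b v i.
Proof.
pose c i := a * coord X b u i + coord X b v i.
suff /coord_uniq -> : is_coord X b (a *: u + v) c by [].
have eu := coord_off (v := u); have ev := coord_off (v := v).
split.
- apply: (sub_finite_set (B := [set i | coord X b u i != 0] `|`
                              [set i | coord X b v i != 0])).
    move=> j /=; rewrite /c.
    case: (eqVneq (coord X b u j) 0) => [->|_ _]; last by left.
    by rewrite mulr0 add0r => ?; right.
  by rewrite finite_setU; split; apply: coord_finite.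
- move=> j /=; apply: contraNP => nX.
  by rewrite /c !coord_out// mulr0 addr0.
- rewrite {1}(coord_sum u) {1}(coord_sum v).
  rewrite -(fsum_lin _ (coord_finite u) _ (coord_finite v)).
  + by apply: eq_fsbigr => j _; rewrite /c scalerDl scalerA.
  + by move=> j _ /eu ->; rewrite scale0r.
  + by move=> j _ /ev ->; rewrite scale0r.
Qed.

Lemma coord0 i : coord X b 0 i = 0.
Proof.
by have := coord_lin (-1) 0 0 i; rewrite scaler0 addr0 mulN1r addNr.
Qed.

Lemma coordD u v i : coord X b (u + v) i = coord X b u i + coord X b v i.
Proof. by have := coord_lin 1 u v i; rewrite scale1r mul1r. Qed.

Lemma coordZ a u i : coord X b (a *: u) i = a * coord X b u i.
Proof. by have := coord_lin a u 0 i; rewrite addr0 coord0 addr0. Qed.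

Lemma coord_basis i j : X i -> coord X b (b i) j = (i == j)%:R.
Proof.
move=> Xi.
suff /coord_uniq -> : is_coord X b (b i) (fun j => (i == j)%:R) by [].
split.
- apply: sub_finite_set (finite_set1 i) => k /=.
  by case: (eqVneq i k) => [->//|_]; rewrite eqxx.
- by move=> k /=; case: (eqVneq i k) => [<-//|_]; rewrite eqxx.
- rewrite (fsum_delta Xi) ?eqxx ?scale1r// => k _ /eqP.
  by rewrite eq_sym => /negbTE ->; rewrite scale0r.
Qed.

(** Linear induction that keeps track of the indices which occur in v: a
    property of v need only be known for the basis vectors in its support. *)
Lemma basis_ind (Q : I -> Prop) (Z : V -> Prop) v :
  Z 0 -> (forall a u w, Z u -> Z w -> Z (a *: u + w)) ->
  (forall i, X i -> Q i -> Z (b i)) ->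
  (forall i, coord X b v i != 0 -> Q i) -> Z v.
Proof.
move=> Z0 ZD Zb Qv; rewrite (coord_sum v).
rewrite (fsum_finite (coord_finite v)); last first.
  by move=> i _ /coord_off ->; rewrite scale0r.
rewrite big_seq; apply: (big_rec Z) => // i w.
rewrite in_fset_set ?inE; last exact: finite_setIr (coord_finite v).
by move=> [Xi ci] Zw; apply: ZD => //; apply: Zb => //; apply: Qv.
Qed.

Section Extension.
Context (V' : lmodType K) (g : I -> V').

Definition basis_ext v : V' := \sum_(i \in X) coord X b v i *: g i.

Lemma basis_ext_lin a u v :
  basis_ext (a *: u + v) = a *: basis_ext u + basis_ext v.
Proof.
have eu := coord_off (v := u); have ev := coord_off (v := v).
rewrite -(fsum_lin _ (coord_finite u) _ (coord_finite v)).
- by apply: eq_fsbigr => j _; rewrite coord_lin scalerDl scalerA.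
- by move=> j _ /eu ->; rewrite scale0r.
- by move=> j _ /ev ->; rewrite scale0r.
Qed.

Lemma basis_extE i : X i -> basis_ext (b i) = g i.
Proof.
move=> Xi; rewrite /basis_ext (fsum_delta Xi) ?coord_basis// ?eqxx ?scale1r//.
by move=> k _ /eqP; rewrite coord_basis// eq_sym => /negbTE ->; rewrite scale0r.
Qed.

End Extension.
End Bases.

(** * Length in a Coxeter group *)
Section CoxeterGroups.
Context (W : groupType) (S : set W) (hW : Coxeter_system S).
Local Open Scope group_scope.
Implicit Types (s t w : W) (u : seq W).

Let word_prod u : W := foldr (fun x y => x * y) 1 u.

Lemma gens_neq1 s : S s -> s != 1.
Proof. by case: hW => _ h _ /h[]. Qed.

Lemma gens_sq s : S s -> s * s = 1.
Proof. by case: hW => _ h _ /h[]. Qed.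

Lemma gens_inv s : S s -> s^-1 = s.
Proof. by move=> /gens_sq /mulg1_eq. Qed.

Lemma gens_mulK s w : S s -> s * (s * w) = w.
Proof. by move=> Ss; rewrite mulgA gens_sq// mul1g. Qed.

Lemma gens_mulKr s w : S s -> w * s * s = w.
Proof. by move=> Ss; rewrite -mulgA gens_sq// mulg1. Qed.

Lemma len_spec w :
  (exists2 u, is_word S u w & size u = len S w) /\
  (forall u, is_word S u w -> (len S w <= size u)%N).
Proof.
rewrite /len; case: pselect => [h|[]].
  case: ex_minnP => n /asboolP[u uw <-] nmin; split; first by exists u.
  by move=> v vw; apply: nmin; apply/asboolP; exists v.
by have [/(_ w) [u uw] _ _] := hW; exists (size u); apply/asboolP; exists u.
Qed.

Lemma is_word_cons s u w : S s -> is_word S u w -> is_word S (s :: u) (s * w).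
Proof.
move=> Ss [uS <-]; split=> // x; rewrite inE => /orP[/eqP->//|]; exact: uS.
Qed.

Lemma is_word_behead s u w :
  is_word S (s :: u) w -> S s /\ is_word S u (s * w).
Proof.
move=> [uS <-]; have Ss : S s by apply: uS; rewrite mem_head.
split=> //; split; first by move=> x xu; apply: uS; rewrite inE xu orbT.
by rewrite /= gens_mulK.
Qed.

Lemma len1 : len S 1 = 0%N.
Proof.
by apply/eqP; rewrite -leqn0; have [_ h] := len_spec 1; apply: (h [::]); split.
Qed.

Lemma len_mull_le s w : S s -> (len S (s * w) <= (len S w).+1)%N.
Proof.
move=> Ss; have [[u uw <-] _] := len_spec w; have [_ h] := len_spec (s * w).
exact/(h (s :: u))/is_word_cons.
Qed.

(** The relations (s t)^n = 1 have even length, so the constant map from the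
    generators to a transposition extends to W.  This parity is what excludes
    l(s w) = l(w). *)
Lemma sign_exists :
  exists eps : W -> bool, forall s w, S s -> eps (s * w) = ~~ eps w.
Proof.
have [_ _ /(_ {perm bool} (fun=> tperm true false))] := hW.
case=> [s t n _ _ _|phi phiM phiS].
  by rewrite tperm2 expg1n.
exists (fun w => odd_perm (phi w)) => s w Ss.
by rewrite phiM phiS// odd_permM odd_tperm.
Qed.

Lemma len_mull s w : S s ->
  len S (s * w) = (len S w).+1 \/ len S w = (len S (s * w)).+1.
Proof.
move=> Ss; have [eps epsM] := sign_exists.
(* Hence eps v records the parity of the length. *)
have epsE v : eps v = eps 1 (+) odd (len S v).
  have [[u + <-] _] := len_spec v.
  elim: u v => [v [_ <-]|t u IH v]; first by rewrite /= addbF.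
  case/is_word_behead=> St /IH; rewrite epsM//= => e.
  by rewrite addbN -e negbK.
have := epsM s w Ss; rewrite (epsE (s * w)) (epsE w) -addbN => /addbI par.
have := len_mull_le w Ss; have := len_mull_le (s * w) Ss.
rewrite gens_mulK// leq_eqVlt => /orP[/eqP->|]; first by right.
rewrite ltnS => h; rewrite leq_eqVlt => /orP[/eqP->|]; first by left.
rewrite ltnS => h'; have e : len S w = len S (s * w).
  by apply/eqP; rewrite eqn_leq h h'.
by move: par; rewrite -e; case: odd.
Qed.

Lemma len_mull_lt s w : S s ->
  (len S (s * w) < len S w)%N -> len S w = (len S (s * w)).+1.
Proof. by move=> /(@len_mull _ w) [->|//]; rewrite ltnNge leqnSn. Qed.

Lemma len_mull_dec s w : S s ->
  {(len S w < len S (s * w))%N} + {(len S (s * w) < len S w)%N}.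
Proof.
move=> Ss; case: ltnP => h; first by left.
by right; have [e|->//] := len_mull w Ss; rewrite e ltnn in h.
Qed.

Lemma len_gens s : S s -> len S s = 1%N.
Proof.
move=> Ss; have := len_mull 1 Ss; rewrite mulg1 len1 => -[//|h].
by have /eqP := gens_neq1 Ss; case: h.
Qed.

Lemma len_inv w : len S w^-1 = len S w.
Proof.
suff h v : (len S v^-1 <= len S v)%N.
  by apply/eqP; rewrite eqn_leq h /= -{1}(invgK w) h.
have [[u uv <-] _] := len_spec v; have [_ h] := len_spec v^-1.
rewrite -(size_rev u); apply: h; split.
  by move=> x; rewrite mem_rev; case: uv => h _ /h.
have foldrM x r : foldr (fun x y => x * y) x r = word_prod r * x.
  by elim: r => /= [|y r ->]; rewrite ?mul1g ?mulgA.
case: uv => + <-; elim: u => [|x r IH] /= hS; first by rewrite invg1.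
have Sx : S x by apply: hS; rewrite mem_head.
rewrite rev_cons foldr_rcons mulg1 foldrM /word_prod IH; last first.
  by move=> y yr; apply: hS; rewrite inE yr orbT.
by rewrite invgM (gens_inv Sx).
Qed.

Lemma gens_invM s w : S s -> (s * w)^-1 = w^-1 * s.
Proof. by move=> Ss; rewrite invgM (gens_inv Ss). Qed.

Lemma len_mulr s w : S s -> len S (w * s) = len S (s * w^-1).
Proof. by move=> Ss; rewrite -len_inv invgM (gens_inv Ss). Qed.

(** Induction along reduced words, read from right to left. *)
Lemma Coxeter_ind (Z : W -> Prop) :
  Z 1 ->
  (forall s w, S s -> len S (s * w) = (len S w).+1 -> Z w -> Z (s * w)) ->
  forall w, Z w.
Proof.
move=> Z1 ZM w; have [[u uw su] _] := len_spec w.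
elim: u w uw su => [w [_ <-]//|s u IH w uw /= su].
have [Ss uw'] := is_word_behead uw.
have [_ /(_ _ uw') le] := len_spec (s * w).
have lw' : len S (s * w) = size u.
  apply/eqP; rewrite eqn_leq le /= -ltnS su.
  by rewrite -{1}(gens_mulK w Ss); apply: len_mull_le.
rewrite -(gens_mulK w Ss); apply: ZM => //; last exact: IH.
by rewrite gens_mulK// lw' su.
Qed.

Lemma Bruhat_len y w : Bruhat_le S y w -> y = w \/ (len S y < len S w)%N.
Proof.
elim=> [|x t _ IH _ lt]; first by left.
by right; case: IH => [->//|/ltn_trans]; apply.
Qed.

Lemma Bruhat_lt_len y w : Bruhat_lt S y w -> (len S y < len S w)%N.
Proof. by case=> /Bruhat_len []. Qed.

End CoxeterGroups.


(** * The group algebra and its bar involution *)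
Section GroupAlgebraTheory.
Context (R : comNzRingType) (G : porderZmodType) (A : comAlgType R).
Context (q : G -> A) (hA : is_group_algebra q).

Let q_basis : is_basis setT q. Proof. by case: hA. Qed.
Let q0 : q 0 = 1. Proof. by case: hA. Qed.
Let qD g h : q (g + h) = q g * q h. Proof. by case: hA. Qed.

Lemma qNM g : q (- g) * q g = 1.
Proof. by rewrite -qD addNr. Qed.

(** The common form of the conditions defining A_(>=0) and A_(>0), which unfold
    to instances of it. *)
Definition exponents_in (Q : G -> Prop) (a : A) :=
  forall g, qcoef q a g != 0 -> Q g.

Lemma exponents_in_lin Q (c : R) a b :
  exponents_in Q a -> exponents_in Q b -> exponents_in Q (c *: a + b).
Proof.
move=> Qa Qb g; rewrite /qcoef coord_lin//.
have [/eqP|/Qa //] := boolP (qcoef q a g == 0); rewrite /qcoef => ->.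
by rewrite mulr0 add0r => /Qb.
Qed.

Lemma exponents_in0 Q : exponents_in Q 0.
Proof. by move=> g; rewrite /qcoef coord0// eqxx. Qed.

Lemma exponents_inD Q a b :
  exponents_in Q a -> exponents_in Q b -> exponents_in Q (a + b).
Proof. by move=> Qa Qb; rewrite -(scale1r a); apply: exponents_in_lin. Qed.

Lemma exponents_inN Q a : exponents_in Q a -> exponents_in Q (- a).
Proof.
move=> Qa; rewrite -scaleN1r -[_ *: _]addr0.
by apply: exponents_in_lin => //; apply: exponents_in0.
Qed.

Lemma exponents_in_q (Q : G -> Prop) g : Q g -> exponents_in Q (q g).
Proof.
move=> Qg h; rewrite /qcoef coord_basis//; case: (eqVneq g h) => [<-//|_].
by rewrite eqxx.
Qed.

Lemma exponents_in_ind (Q : G -> Prop) (Z : A -> Prop) a :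
  Z 0 -> (forall c b b', Z b -> Z b' -> Z (c *: b + b')) ->
  (forall g, Q g -> Z (q g)) -> exponents_in Q a -> Z a.
Proof.
move=> Z0 ZD Zq Qa; apply: (basis_ind q_basis Z0 ZD _ Qa) => g _; exact: Zq.
Qed.

Lemma exponents_inM (Q1 Q2 Q3 : G -> Prop) a b :
  (forall g h, Q1 g -> Q2 h -> Q3 (g + h)) ->
  exponents_in Q1 a -> exponents_in Q2 b -> exponents_in Q3 (a * b).
Proof.
move=> Q123 Q1a Q2b.
apply: (@exponents_in_ind Q1 (fun a => exponents_in Q3 (a * b))) Q1a.
- by rewrite mul0r; apply: exponents_in0.
- by move=> c x y; rewrite mulrDl -scalerAl; apply: exponents_in_lin.
move=> g Q1g.
apply: (@exponents_in_ind Q2 (fun b => exponents_in Q3 (q g * b))) Q2b.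
- by rewrite mulr0; apply: exponents_in0.
- by move=> c x y; rewrite mulrDr -scalerAr; apply: exponents_in_lin.
by move=> h Q2h; rewrite -qD; apply: exponents_in_q; apply: Q123.
Qed.

Lemma A_gt0_const a : A_ge0 q a -> qcoef q a 0 = 0 -> A_gt0 q a.
Proof.
move=> a0 ac g ag; rewrite lt_def a0// andbT.
by apply: contraNneq ag => ->; rewrite ac.
Qed.

Lemma A_gt0W a : A_gt0 q a -> A_ge0 q a.
Proof. by move=> a0 g /a0 /ltW. Qed.

Section Ordered.
Context (hG : totally_ordered_group G).

Lemma addg_ge0 (g h : G) : 0 <= g -> 0 <= h -> 0 <= g + h.
Proof.
case: hG => _ hD g0 h0; apply: le_trans h0 _.
by rewrite -{1}(add0r h); apply: hD.
Qed.

Lemma addg_gt0l (g h : G) : 0 < g -> 0 <= h -> 0 < g + h.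
Proof.
move=> g0 h0; rewrite lt_def addg_ge0 ?(ltW g0)// andbT.
apply/eqP => /eqP; rewrite addrC addr_eq0 => /eqP hg.
have [_ /(_ 0 h g h0)] := hG; rewrite add0r hg addNr => /(lt_le_trans g0).
by rewrite ltxx.
Qed.

Lemma A_ge0M a b : A_ge0 q a -> A_ge0 q b -> A_ge0 q (a * b).
Proof. exact: (@exponents_inM (>= 0) (>= 0) (>= 0) a b addg_ge0). Qed.

Lemma A_gt0Ml a b : A_gt0 q a -> A_ge0 q b -> A_gt0 q (a * b).
Proof. exact: (@exponents_inM (> 0) (>= 0) (> 0) a b addg_gt0l). Qed.

End Ordered.

Lemma qbar_ext : qbar q = basis_ext setT q (fun g => q (- g)).
Proof. by []. Qed.

Lemma qbar_q g : qbar q (q g) = q (- g).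
Proof. by rewrite qbar_ext basis_extE. Qed.

Lemma qbar1 : qbar q 1 = 1.
Proof. by rewrite -q0 qbar_q oppr0. Qed.

Lemma qbar0 : qbar q 0 = 0.
Proof.
have := basis_ext_lin q_basis (fun g => q (- g)) (-1) 0 0.
by rewrite -qbar_ext scaler0 addr0 scaleN1r addNr.
Qed.

Lemma qbarD a b : qbar q (a + b) = qbar q a + qbar q b.
Proof.
have := basis_ext_lin q_basis (fun g => q (- g)) 1 a b.
by rewrite -qbar_ext !scale1r.
Qed.

Lemma qbarM a b : qbar q (a * b) = qbar q a * qbar q b.
Proof.
apply: (@basis_ind _ _ _ _ _ q_basis (fun=> True)
  (fun a => qbar q (a * b) = qbar q a * qbar q b)) => //.
- by rewrite mul0r qbar0 mul0r.
- move=> c x y hx hy; rewrite mulrDl -scalerAl.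
  by rewrite qbar_ext !basis_ext_lin// -qbar_ext hx hy mulrDl scalerAl.
move=> g _ _.
apply: (@basis_ind _ _ _ _ _ q_basis (fun=> True)
  (fun b => qbar q (q g * b) = qbar q (q g) * qbar q b)) => //.
- by rewrite mulr0 qbar0 mulr0.
- move=> c x y hx hy; rewrite mulrDr -scalerAr.
  by rewrite qbar_ext !basis_ext_lin// -qbar_ext hx hy mulrDr scalerAr.
by move=> h _ _; rewrite -qD !qbar_q opprD qD.
Qed.

End GroupAlgebraTheory.

(** * The Hecke algebra and its anti-automorphism *)
Section HeckeAlgebra.
Context (W : groupType) (S : set W) (hW : Coxeter_system S).
Context (R : comNzRingType) (G : porderZmodType) (A : comAlgType R).
Context (q : G -> A) (hA : is_group_algebra q) (L : W -> G).
Context (H : unitAlgType A) (T : W -> H) (hH : is_Hecke_algebra q S L T).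

Let T_basis : is_basis setT T. Proof. by case: hH. Qed.
Let T1 : T 1%g = 1. Proof. by case: hH. Qed.
Let T_up s w : S s -> (len S w < len S (s * w)%g)%N ->
  T s * T w = T (s * w)%g.
Proof. by case: hH => _ _ h _; apply: h. Qed.
Let T_down s w : S s -> (len S (s * w)%g < len S w)%N ->
  T s * T w = T (s * w)%g + (q (L s) - q (- L s)) *: T w.
Proof. by case: hH => _ _ _; apply. Qed.

Lemma T_sq s : S s -> T s * T s = 1 + (q (L s) - q (- L s)) *: T s.
Proof.
move=> Ss; rewrite T_down ?(gens_sq hW)//  ?T1//.
by rewrite (len1 hW) (len_gens hW).
Qed.

Lemma T_inv s : S s -> (T s)^-1 = T s - (q (L s) - q (- L s))%:A.
Proof.
move=> Ss; set c := q (L s) - q (- L s).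
have e : (T s - c%:A) * T s = 1.
  by rewrite mulrBl T_sq// -/c mulr_algl addrK.
have e' : T s * (T s - c%:A) = 1.
  by rewrite mulrBr T_sq// -/c mulr_algr addrK.
have u : T s \is a GRing.unit by apply/unitrP; exists (T s - c%:A).
by apply: (mulrI u); rewrite divrr.
Qed.

Lemma Hbar_T s : S s -> Hbar q T (T s) = T s - (q (L s) - q (- L s))%:A.
Proof.
move=> Ss; rewrite /Hbar (@fsum_delta _ _ _ _ s)//.
  by rewrite coord_basis// eqxx (qbar1 hA) scale1r (gens_inv hW)// T_inv.
move=> w _ /eqP; rewrite coord_basis// eq_sym => /negbTE ->.
by rewrite (qbar0 hA) scale0r.
Qed.

(** The multiplication rules are given on the left only.  A reduced word of w s
    that ends in s starts with a left descent of w, which is peeled off. *)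
Lemma T_right_up s w : S s -> (len S w < len S (w * s)%g)%N ->
  T w * T s = T (w * s)%g.
Proof.
move=> Ss; move: w; apply: (Coxeter_ind hW) => [_|t w St ltw IH lt].
  by rewrite T1 mul1r mul1g.
have lws : len S (w * s)%g = (len S w).+1.
  apply/eqP; rewrite eqn_leq; apply/andP; split.
    by rewrite (len_mulr hW)// -(len_inv hW w); apply: len_mull_le.
  rewrite -ltnS -ltw; apply: leq_trans lt _.
  by rewrite -mulgA; apply: len_mull_le.
rewrite -(T_up St) ?ltw// -mulrA IH ?lws// T_up// ?mulgA// lws.
by rewrite -ltw.
Qed.

Lemma T_right_down s w : S s -> (len S (w * s)%g < len S w)%N ->
  T w * T s = T (w * s)%g + (q (L s) - q (- L s)) *: T w.
Proof.
move=> Ss lt; have e : T (w * s)%g * T s = T w.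
  by rewrite T_right_up// (gens_mulKr hW).
by rewrite -{1}e -mulrA T_sq// mulrDr mulr1 -scalerAr e.
Qed.

Definition flip : H -> H := basis_ext setT T (fun w => T w^-1%g).

Lemma flip_lin a h k : flip (a *: h + k) = a *: flip h + flip k.
Proof. exact: basis_ext_lin. Qed.

Lemma flip_T w : flip (T w) = T w^-1%g.
Proof. exact: basis_extE. Qed.

Lemma flip_gens s : S s -> flip (T s) = T s.
Proof. by move=> Ss; rewrite flip_T (gens_inv hW). Qed.

Lemma flip0 : flip 0 = 0.
Proof. by have := flip_lin (-1) 0 0; rewrite scaler0 addr0 scaleN1r addNr. Qed.

Lemma flip1 : flip 1 = 1.
Proof. by rewrite -T1 flip_T invg1. Qed.

(** The left and the right multiplication rules are exchanged by w |-> w^-1,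
    which preserves length. *)
Lemma flip_gensM s h : S s -> flip (T s * h) = flip h * T s.
Proof.
move=> Ss; apply: (@basis_ind _ _ _ _ _ T_basis (fun=> True)
  (fun h => flip (T s * h) = flip h * T s)) => //.
- by rewrite mulr0 flip0 mul0r.
- move=> a x y hx hy.
  by rewrite mulrDr -scalerAr !flip_lin hx hy mulrDl scalerAl.
move=> w _ _; rewrite flip_T.
have e : len S (w^-1 * s)%g = len S (s * w)%g.
  by rewrite -(gens_invM hW)// len_inv.
case: (len_mull_dec hW w Ss) => lt.
  by rewrite T_up// flip_T (gens_invM hW)// T_right_up// e len_inv.
rewrite T_down// addrC flip_lin !flip_T (gens_invM hW)// addrC.
by rewrite T_right_down// e len_inv.
Qed.

Lemma flipM h k : flip (h * k) = flip k * flip h.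
Proof.
apply: (@basis_ind _ _ _ _ _ T_basis (fun=> True)
  (fun h => flip (h * k) = flip k * flip h)) => //.
- by rewrite mul0r flip0 mulr0.
- move=> a x y hx hy.
  by rewrite mulrDl -scalerAl !flip_lin hx hy mulrDr scalerAr.
move=> w _ _; move: w; apply: (Coxeter_ind hW) => [|s w Ss lt IH].
  by rewrite T1 mul1r flip1 mulr1.
have e : T s * T w = T (s * w)%g by rewrite T_up// lt.
by rewrite -e -mulrA !(flip_gensM _ Ss) IH mulrA.
Qed.

End HeckeAlgebra.

(** * Ascents and descents in an ideal *)
Section IdealPartition.
Context (W : groupType) (S : set W) (hW : Coxeter_system S).
Context (J E : set W) (hJE : ideal_in_D S J E).
Implicit Types s w : W.

Lemma ideal_down s w : S s -> E w -> (len S (s * w)%g < len S w)%N ->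
  E (s * w)%g.
Proof.
move=> Ss Ew lt; have [_ _ down] := hJE; apply: down Ew _.
exists s; first by rewrite (gens_mulK hW).
by rewrite (len_gens hW Ss) (len_mull_lt hW Ss lt).
Qed.

Lemma SD_mull s w : SD S E w s -> SA S E (s * w)%g s.
Proof. by case=> Ss Ew lt Esw; split=> //; rewrite (gens_mulK hW). Qed.

Lemma SA_mull s w : SA S E w s -> SD S E (s * w)%g s.
Proof. by case=> Ss Ew lt Esw; split=> //; rewrite (gens_mulK hW). Qed.

Lemma Asc_notDes s w : Asc S J E w s -> ~ Des S J E w s.
Proof.
case=> [[_ _ up Esw]|[_ _ up Dsw _]] [[_ _ dn _]|[_ _ _ nD]].
- by move: (ltn_trans up dn); rewrite ltnn.
- by apply: nD; case: hJE => _ ED _; apply: ED.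
- by move: (ltn_trans up dn); rewrite ltnn.
- exact: nD.
Qed.

Lemma Asc_or_Des s w : S s -> E w -> Asc S J E w s \/ Des S J E w s.
Proof.
move=> Ss Ew; case: (len_mull_dec hW w Ss) => [up|dn].
  have [Esw|nEsw] := pselect (E (s * w)%g); first by left; left.
  have [Dsw|nDsw] := pselect (D_ S J (s * w)%g); first by left; right.
  by right; right.
by right; left; split=> //; apply: ideal_down.
Qed.

Lemma notAsc_Des s w : S s -> E w -> ~ Asc S J E w s -> Des S J E w s.
Proof. by move=> Ss Ew nA; have [/nA|] := Asc_or_Des Ss Ew. Qed.

(** Weak descents leave D_J, hence also E; so the term D_(s z) can only occur
    for strong descents. *)
Lemma WD_mull s w : WD S J E w s -> ~ E (s * w)%g.
Proof. by move=> [_ _ _ nD] Esw; apply: nD; case: hJE => _ ED _; apply: ED. Qed.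

Lemma Des_S s w : Des S J E w s -> S s. Proof. by case=> -[]. Qed.
Lemma Des_E s w : Des S J E w s -> E w. Proof. by case=> -[]. Qed.
Lemma Asc_S s w : Asc S J E w s -> S s. Proof. by case=> -[]. Qed.
Lemma Asc_E s w : Asc S J E w s -> E w. Proof. by case=> -[]. Qed.

Lemma Asc_Des_neq s v z : Asc S J E v s -> Des S J E z s -> v <> z.
Proof. by move=> /Asc_notDes h Dz e; apply: h; rewrite e. Qed.

End IdealPartition.

(** * The canonical basis and its dual *)
Section WgraphIdeal.
Context (W : groupType) (S : set W) (hW : Coxeter_system S).
Context (G : porderZmodType) (hG : totally_ordered_group G) (L : W -> G).
Context (R : comNzRingType) (A : comAlgType R) (q : G -> A).
Context (hA : is_group_algebra q).
Context (H : unitAlgType A) (T : W -> H) (hH : is_Hecke_algebra q S L T).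
Context (J E : set W) (M : lmodType A) (act : H -> {linear M -> M}).
Context (Gam : W -> M) (barM : M -> M).
Context (hE : is_Wgraph_ideal q S L T J E act Gam barM).
Context (C : W -> M) (hC : is_KL_basis q S E Gam barM C).

Let hJE : ideal_in_D S J E := ideal_ideal hE.
Let Gam_basis : is_basis E Gam := ideal_basis hE.

Lemma act_lin h k a x : act (a *: h + k) x = a *: act h x + act k x.
Proof. by case: (ideal_Hmodule hE). Qed.

Lemma act1 x : act 1 x = x.
Proof. by case: (ideal_Hmodule hE). Qed.

Lemma actM h k x : act (h * k) x = act h (act k x).
Proof. by case: (ideal_Hmodule hE). Qed.

(** C spans M: by induction on the length of w, Gam_w is C_w minus a combination
    of Gam_y with y < w in the Bruhat order, hence with y shorter than w. *)
Lemma KL_ind (Z : M -> Prop) :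
  Z 0 -> (forall a x y, Z x -> Z y -> Z (a *: x + y)) ->
  (forall w, E w -> Z (C w)) -> forall x, Z x.
Proof.
move=> Z0 ZD ZC x.
apply: (@basis_ind _ _ _ _ _ Gam_basis (fun=> True)) => // w.
have [n] := ubnP (len S w); elim: n w => // n IH w lt Ew _.
(* The diagonal coefficient of C w is 1, so the support of C w - Gam w lies
   strictly below w. *)
have Zd : Z (C w - Gam w).
  apply: (@basis_ind _ _ _ _ _ Gam_basis
    (fun y => (len S y < len S w)%N)) => // [y Ey lyw|y cy].
    by apply: IH => //; apply: leq_trans lyw _; rewrite -ltnS.
  have Ey : E y.
    by apply: contrapT => nE; move: cy; rewrite coord_out// eqxx.
  apply: contrapT => /negP; rewrite -leqNgt => lwy; move/eqP: cy; apply.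
  rewrite -scaleN1r addrC coord_lin// coord_basis//.
  have [<-|nwy] := eqVneq w y; first by rewrite (KL_diag hC)// mulr1 addNr.
  rewrite mulr0 add0r (KL_supp hC)// => /(Bruhat_len)[ywe|].
    by rewrite ywe eqxx in nwy.
  by rewrite ltnNge lwy.
have -> : Gam w = -1 *: (C w - Gam w) + C w.
  by rewrite scaleN1r opprB subrK.
by apply: ZD => //; apply: ZC.
Qed.

Lemma KL_ext (f g : M -> A) : scalar f -> scalar g ->
  (forall w, E w -> f (C w) = g (C w)) -> f =1 g.
Proof.
move=> fL gL fg; apply: KL_ind => [|a x y hx hy|//]; last by rewrite fL gL hx hy.
have z0 (h : M -> A) : scalar h -> h 0 = 0.
  by move=> /(_ (-1) 0 0); rewrite scaler0 addr0 mulN1r addNr.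
by rewrite !z0.
Qed.

Section DualBasis.
Context (D : W -> dual M).
Context (hD : forall z w, E z -> E w -> D z (C w) = (z == w)%:R).

Lemma dual_eq_KL (f g : dual M) : (forall w, E w -> f (C w) = g (C w)) -> f = g.
Proof.
by move=> fg; apply/dual_ext/KL_ext => // a x y; rewrite linearP.
Qed.

(** This makes the sums over u pointwise finite, whatever the number of u above
    z in the Bruhat order. *)
Lemma dual_basis_finite x : finite_set [set z | E z /\ D z x != 0].
Proof.
move: x; apply: KL_ind => [|a x y fx fy|w Ew].
- by apply: sub_finite_set (finite_set0 W) => z [_]; rewrite linear0 eqxx.
- apply: sub_finite_set (_ : finite_set (_ `|` _)); last first.
    by rewrite finite_setU; split; [exact: fx|exact: fy].
  move=> z [Ez]; rewrite linearP /=; case: (eqVneq (D z x) 0) => [->|zx _].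
    by rewrite scaler0 add0r; right.
  by left.
- apply: sub_finite_set (finite_set1 w) => z [Ez]; rewrite hD//.
  by case: (eqVneq z w) => // _; rewrite eqxx.
Qed.

Lemma dual_basis_off x z : E z -> ~ [set z | E z /\ D z x != 0] z -> D z x = 0.
Proof. by move=> Ez nz; apply/eqP/negPn/negP => zx; apply: nz. Qed.

Lemma dual_basis_sum_lin (U : set W) (c : W -> A) a x y : U `<=` E ->
  \sum_(u \in U) c u * D u (a *: x + y)
    = a * (\sum_(u \in U) c u * D u x) + \sum_(u \in U) c u * D u y.
Proof.
move=> UE.
rewrite -(@fsum_lin _ A^o _ _ _ _ _ _ a (dual_basis_finite x) _
                    (dual_basis_finite y)).
- by apply: eq_fsbigr => u _; rewrite linearP /= mulrDr /GRing.scale /= mulrCA.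
- by move=> u /UE Eu /(dual_basis_off Eu) ->; rewrite mulr0.
- by move=> u /UE Eu /(dual_basis_off Eu) ->; rewrite mulr0.
Qed.

Lemma dual_basis_sum_KL (U : set W) (c : W -> A) w : U `<=` E -> E w ->
  \sum_(u \in U) c u * D u (C w) = if `[< U w >] then c w else 0.
Proof.
move=> UE Ew; case: asboolP => Uw.
  rewrite (fsum_delta Uw) ?hD ?eqxx ?mulr1// => u /UE Eu /eqP/negbTE nuw.
  by rewrite hD// nuw mulr0.
apply: fsbig1 => u Uu; have /eqP/negbTE nuw : u <> w.
  by move=> e; rewrite e in Uu.
by rewrite hD ?nuw ?mulr0//; apply: UE.
Qed.

Lemma KL_expansion x : x = \sum_(z \in E) D z x *: C z.
Proof.
move: x; apply: KL_ind => [|a x y hx hy|w Ew].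
- by rewrite fsbig1// => z Ez; rewrite linear0 scale0r.
- rewrite {1}hx {1}hy.
  rewrite -(fsum_lin _ (dual_basis_finite x) _ (dual_basis_finite y)).
  + by apply: eq_fsbigr => z _; rewrite linearP /= scalerDl scalerA.
  + by move=> z Ez /(dual_basis_off Ez) ->; rewrite scale0r.
  + by move=> z Ez /(dual_basis_off Ez) ->; rewrite scale0r.
- rewrite (fsum_delta Ew) ?hD ?eqxx ?scale1r// => z Ez /eqP/negbTE nzw.
  by rewrite hD// nzw scale0r.
Qed.

Lemma dual_basis_finite_basis : finite_set E -> is_basis E D.
Proof.
move=> finE f; pose c z := if `[< E z >] then f (C z) else 0.
have c0 z : c z != 0 -> E z by rewrite /c; case: asboolP; rewrite ?eqxx.
have val (d : W -> A) w : E w -> (\sum_(z \in E) d z *: D z) (C w) = d w.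
  move=> Ew; rewrite (dual_sumE _ finE)//.
  have := dual_basis_sum_KL d (@subset_refl _ E) Ew.
  by case: asboolP => // _; apply.
exists c; split.
  split=> //; first exact: sub_finite_set finE.
  by apply: dual_eq_KL => w Ew; rewrite val// /c; case: asboolP.
move=> d [_ dE fd]; apply/funext => w; rewrite /c; case: asboolP => [Ew|nE].
  by rewrite fd val.
by apply/esym/eqP/negPn/negP => /dE.
Qed.

Lemma barM_additive x y : barM (x + y) = barM x + barM y.
Proof.
by have := ideal_bar_semilinear hE 1 x y; rewrite !scale1r (qbar1 hA) scale1r.
Qed.

Lemma barM0 : barM 0 = 0.
Proof. by apply: (addrI (barM 0)); rewrite -barM_additive !addr0. Qed.

Lemma dual_basis_bar x z : E z -> D z (barM x) = qbar q (D z x).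
Proof.
move=> Ez; move: x; apply: KL_ind => [|a x y hx hy|w Ew].
- by rewrite barM0 linear0 (qbar0 hA).
- rewrite (ideal_bar_semilinear hE) !linearP /= hx hy (qbarD hA).
  by rewrite /GRing.scale /= (qbarM hA).
- by rewrite (KL_bar hC)// hD//; case: eqVneq; rewrite ?(qbar1 hA) ?(qbar0 hA).
Qed.

(** * Matrix coefficients of T_s *)
Section WgraphCoefs.
Context (m : W -> W -> W -> A) (hm : are_W_graph_coefs q S L T J E act C m).

(** At an ascent s of v the C-coordinates of this deviation, taken at C v, are
    the edge weights; the weights are studied through it rather than through
    the separate formulas for strong and weak ascents. *)
Let Tdev s x := act (T s) x - q (L s) *: x.

Lemma Tdev_lin s a x y : Tdev s (a *: x + y) = a *: Tdev s x + Tdev s y.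
Proof.
rewrite /Tdev linearP /= scalerDr opprD scalerBr addrACA; congr (_ - _ + _).
by rewrite !scalerA mulrC.
Qed.

Lemma dual_basis_T_Des s z v : 0 < L s -> E z -> Des S J E v s ->
  D z (act (T s) (C v)) = - q (- L s) * (z == v)%:R.
Proof.
move=> Ls Ez Dv; rewrite (coefs_D hm)// linearZ /= hD//; exact: Des_E Dv.
Qed.

(** At a weak ascent the exceptional value at z = s v is void, as s v is not
    in E. *)
Lemma dual_mu_WA s z v : E z -> S s -> WA S J E v s ->
  dual_mu S m s v z = if `[< Bruhat_lt S z v >] then m s z v else 0.
Proof.
move=> Ez Ss [_ _ _ _ nE]; rewrite /dual_mu; case: eqP => // e; case: nE.
by rewrite e (gens_mulK hW).
Qed.

Lemma KL_sum_D (U : set W) (c : W -> A) z : U `<=` E -> E z ->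
  finite_set [set u | U u /\ c u != 0] ->
  D z (\sum_(u \in U) c u *: C u) = if `[< U z >] then c z else 0.
Proof.
move=> UE Ez fc; rewrite (@fsum_morph _ _ _ (D z : M -> A) U _ _ _ _ fc).
- case: asboolP => Uz.
    rewrite (fsum_delta Uz).
      by rewrite linearZ /= hD// eqxx; exact: mulr1.
    move=> u /UE Eu /eqP; rewrite eq_sym linearZ /= hD// => /negbTE ->.
    by rewrite scaler0.
  apply: fsbig1 => u Uu; have /eqP/negbTE nuz : z <> u.
    by move=> e; apply: Uz; rewrite e.
  by rewrite linearZ /= hD ?nuz ?scaler0//; apply: UE.
- exact: linear0.
- exact: linearD.
- move=> u Uu nu; have -> : c u = 0; last by rewrite scale0r.
  by apply/eqP/negPn/negP => cu; apply: nu.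
Qed.

(** The strong and the weak case merge: dual_mu takes the value 1 at z = s v,
    which accounts for the additional term C_(s v). *)
Lemma dual_basis_T_Asc s z v : 0 < L s -> E z -> Asc S J E v s ->
  D z (act (T s) (C v)) = q (L s) * (z == v)%:R +
    if `[< Des S J E z s >] then dual_mu S m s v z else 0.
Proof.
move=> Ls Ez Av; have Ss := Asc_S Av; have Ev := Asc_E Av.
pose U := [set y | [/\ E y, Bruhat_lt S y v & Des S J E y s]].
have UE : U `<=` E by move=> y [].
have fU : finite_set [set u | U u /\ m s u v != 0].
  apply: sub_finite_set (coefs_finite hm Ss Ls Av).
  by move=> y [[? ? ?] ?].
have DU := KL_sum_D UE Ez fU.
case: Av => [SAv|WAv]; last first.
  rewrite (coefs_WA hm)// linearD linearZ /= hD// DU; congr (_ + _).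
  rewrite (dual_mu_WA Ez)//; case: (asboolP (Des S J E z s)) => Dz; last first.
    by case: asboolP => // -[].
  case: (asboolP (U z)) => [[_ lt _]|nU]; case: asboolP => // zv.
  by case: nU.
rewrite (coefs_SA hm)// !linearD linearZ /= hD// DU -addrA; congr (_ + _).
have SDsv := SA_mull hW SAv.
have Esv : E (s * v)%g by case: SDsv.
rewrite hD// /dual_mu; have -> : (v == (s * z)%g) = (z == (s * v)%g).
  by apply/eqP/eqP => ->; rewrite (gens_mulK hW).
case: eqVneq => [zsv|nzsv].
  have Dz : Des S J E z s by left; rewrite zsv.
  rewrite (asboolT Dz) asboolF ?addr0// => -[_ lt _].
  have := Bruhat_lt_len lt; rewrite zsv => lt2.
  by case: SAv => _ _ lt1 _; move: (ltn_trans lt1 lt2); rewrite ltnn.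
rewrite add0r; case: (asboolP (Des S J E z s)) => Dz; last first.
  by case: asboolP => // -[].
case: (asboolP (U z)) => [[_ lt _]|nU]; case: asboolP => // zv.
by case: nU.
Qed.

(** Applying bar changes T_s C_v by (q^(L s) - q^(- L s)) C_v, and this is also
    the change of q^(L s) C_v. *)
Lemma Tdev_bar s v : S s -> E v -> barM (Tdev s (C v)) = Tdev s (C v).
Proof.
move=> Ss Ev; rewrite /Tdev addrC -scaleNr (ideal_bar_semilinear hE).
rewrite (ideal_bar_act hE) (KL_bar hC)// (Hbar_T hW hA hH)//.
have -> : qbar q (- q (L s)) = - q (- L s).
  apply/eqP; rewrite -addr_eq0 -(qbar_q hA) addrC -(qbarD hA) addrN.
  by rewrite (qbar0 hA).
set c := q (L s) - q (- L s).
have -> : act (T s - c%:A) (C v) = act (T s) (C v) - c *: C v.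
  by rewrite addrC -scaleNr act_lin act1 addrC scaleNr.
by rewrite addrCA -scalerBl addrC /c opprB addKr.
Qed.

Lemma dual_basis_Tdev s z v : 0 < L s -> E z -> Asc S J E v s ->
  D z (Tdev s (C v)) =
    if `[< Des S J E z s >] then dual_mu S m s v z else 0.
Proof.
move=> Ls Ez Av; have Ev := Asc_E Av.
rewrite /Tdev linearB linearZ /= dual_basis_T_Asc// hD//.
by rewrite addrC addKr.
Qed.

Lemma dual_mu_bar s z v : 0 < L s -> Asc S J E v s -> Des S J E z s ->
  qbar q (dual_mu S m s v z) = dual_mu S m s v z.
Proof.
move=> Ls Av Dz; have Ez := Des_E Dz.
have := dual_basis_Tdev Ls Ez Av; rewrite asboolT// => <-.
by rewrite -dual_basis_bar// Tdev_bar//; [exact: Asc_S Av|exact: Asc_E Av].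
Qed.

(** Read off from the action of T_s on Gam_y.  If s is an ascent of y, only
    Gam_(s y) or the terms with r^s contribute, both with coefficient in A_(>0)
    after scaling.  If s is a descent of y, z is reached only if y = z, and there
    the negative power q^(- L s) is just compensated, which gives the weaker
    conclusion. *)
Lemma coord_Tdev_Gam s z y : 0 < L s -> Des S J E z s -> E y ->
  let e := q (L s) * coord E Gam (Tdev s (Gam y)) z in
  A_ge0 q e /\ (y <> z -> A_gt0 q e).
Proof.
move=> Ls Dz Ey; have Ss := Des_S Dz; have Ez := Des_E Dz.
have qge0 g : 0 <= g -> A_ge0 q (q g) by exact: (exponents_in_q hA).
have one_ge0 : A_ge0 q 1 by case: hA => _ <- _; apply: qge0.
have q_gt0 : A_gt0 q (q (L s)).
  by apply: (exponents_in_q hA (Q := fun g => 0 < g)).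
have zero_gt0 : A_gt0 q 0 by exact: (exponents_in0 hA).
have qge0_L := qge0 _ (ltW Ls).
have qqN : q (L s) * q (- L s) = 1 by rewrite mulrC (qNM hA).
pose d := (y == z)%:R : A.
(* In the descent cases the scaled coordinate is - (c * d) with c = 1 for a
   strong descent and c = 1 + q^(2 L s) for a weak one. *)
have diag c : A_ge0 q c ->
    A_ge0 q (- (c * d)) /\ (y <> z -> A_gt0 q (- (c * d))).
  move=> c0; rewrite /d; case: eqP => yz; rewrite ?mulr1 ?mulr0 ?oppr0; split=> //.
  - exact: (exponents_inN hA).
  - exact: A_gt0W.
rewrite /Tdev.
have [Ay|Dy] := Asc_or_Des hW hJE Ss Ey; last first.
  case: Dy => [SDy|WDy].
    rewrite (ideal_SD hE)//; have SAsy := SD_mull hW SDy.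
    have Esy := Asc_E (or_introl SAsy : Asc S J E _ _).
    have nsyz : ((s * y)%g == z) = false.
      apply/eqP/(Asc_Des_neq hJE _ Dz); by left.
    rewrite -addrA -scalerBl addrC coord_lin// !coord_basis// nsyz addr0.
    rewrite addrAC subrr sub0r mulrA mulrN qqN mulN1r -/d -[d]mul1r.
    exact: diag.
  rewrite (ideal_WD hE)// -scalerBl coordZ// coord_basis// -/d.
  rewrite -opprD mulNr mulrN mulrA; apply: diag.
  rewrite mulrDr qqN; apply: (exponents_inD hA) => //.
  exact: (A_ge0M hA hG).
have nyz : (y == z) = false by apply/eqP/(Asc_Des_neq hJE Ay Dz).
suff h : A_gt0 q
    (q (L s) * coord E Gam (act (T s) (Gam y) - q (L s) *: Gam y) z).
  by split; [exact: A_gt0W|move=> _].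
case: Ay => [SAy|WAy].
  have Esy := Des_E (or_introl (SA_mull hW SAy) : Des S J E _ _).
  rewrite (ideal_SA hE)// addrC -scaleNr coord_lin// !coord_basis//.
  rewrite nyz mulr0 add0r.
  by case: (_ == z); rewrite ?mulr1 ?mulr0.
have [r rP ->] := ideal_WA hE WAy.
rewrite addrAC subrr add0r -scaleN1r coordZ// mulN1r mulrN.
apply: (exponents_inN hA).
apply: (@fsum_closed _ _
  (fun x => A_gt0 q (q (L s) * coord E Gam x z))).
- by rewrite coord0// mulr0.
- by move=> x x' hx hx'; rewrite coordD// mulrDr; apply: (exponents_inD hA).
move=> i [Ei lt]; have [a a0 ->] := rP _ Ei lt.
rewrite coordZ// coord_basis//; case: (i == z); rewrite ?mulr0// mulr1.
by apply/(A_gt0Ml hA hG) => //; apply/(A_ge0M hA hG)/A_gt0W.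
Qed.

(** The index y = z, at which only A_(>=0) is known for Gam_y, comes with the
    coefficient P_(z,v), which is in A_(>0) because z is not v. *)
Lemma coord_Tdev_KL s z v : 0 < L s -> Des S J E z s -> Asc S J E v s ->
  A_gt0 q (q (L s) * coord E Gam (Tdev s (C v)) z).
Proof.
move=> Ls Dz Av; have Ev := Asc_E Av; have Ez := Des_E Dz.
have nvz : v <> z by apply: (Asc_Des_neq hJE Av Dz).
pose g x := q (L s) * coord E Gam (Tdev s x) z.
have g_lin a x y : g (a *: x + y) = a * g x + g y.
  by rewrite /g Tdev_lin coord_lin// mulrDr mulrCA.
have g0 : g 0 = 0.
  by have := g_lin (-1) 0 0; rewrite scaler0 addr0 mulN1r addNr.
have gD x y : g (x + y) = g x + g y.
  by have := g_lin 1 x y; rewrite scale1r mul1r.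
rewrite -/(g (C v)) {1}(coord_sum Gam_basis (C v)).
rewrite (fsum_morph g0 gD (coord_finite Gam_basis (C v))); last first.
  by move=> i _ ci0; rewrite (coord_off ci0) scale0r.
apply: fsum_closed => [||y Ey].
- exact: (exponents_in0 hA).
- exact: (exponents_inD hA).
have := g_lin (coord E Gam (C v) y) (Gam y) 0; rewrite addr0 g0 addr0 => ->.
have [e0 ey] := coord_Tdev_Gam Ls Dz Ey.
have [yz|nyz] := pselect (y = z); last first.
  by rewrite mulrC; apply: (A_gt0Ml hA hG); [exact: ey|exact: (KL_ge0 hC)].
apply: (A_gt0Ml hA hG) => //; apply: (A_gt0_const); first exact: (KL_ge0 hC).
by apply: (KL_const hC) => //; rewrite yz; apply/nesym.
Qed.

(** Downward induction on the length of z: after removing its C_z term, X has at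
    z only contributions dual_mu(y) P_(z,y) with z < y. *)
Lemma dual_mu_gt0 s z v : 0 < L s -> Asc S J E v s -> Des S J E z s ->
  A_gt0 q (q (L s) * dual_mu S m s v z).
Proof.
move=> Ls Av.
pose X := Tdev s (C v).
have DX y : E y -> ~ Des S J E y s -> D y X = 0.
  by move=> Ey nD; rewrite dual_basis_Tdev// asboolF.
have DX' y : E y -> Des S J E y s -> D y X = dual_mu S m s v y.
  by move=> Ey Dy; rewrite dual_basis_Tdev// asboolT.
have gt0_0 : A_gt0 q 0 by exact: (exponents_in0 hA).
(* A nonzero weight forces the length of z to be at most (len S v).+1, the value
   at z = s v; beyond this bound the truncated difference is 0. *)
have [n] := ubnP ((len S v).+2 - len S z).
elim: n z => // n IH z lt Dz; have Ez := Des_E Dz.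
have [zv|vz] := leqP (len S z) (len S v).+1; last first.
  rewrite /dual_mu; case: eqP => [e|_].
    have := len_mull_le hW (s * z)%g (Des_S Dz).
    by rewrite (gens_mulK hW _ (Des_S Dz)) leqNgt -e vz.
  case: asboolP => [/Bruhat_lt_len h|_]; rewrite ?mulr0//.
  by move: (ltn_trans (ltnW vz) h); rewrite ltnn.
(* As P_(z,z) = 1, the weight is the Gam_z-coordinate of X minus that of what
   remains of X without its C_z term. *)
have -> : dual_mu S m s v z =
    coord E Gam X z - coord E Gam (X - D z X *: C z) z.
  rewrite (coordD Gam_basis X) -scaleNr coordZ// (KL_diag hC)// mulr1 DX'//.
  by rewrite opprD opprK addrA subrr add0r.
rewrite mulrBr; apply: (exponents_inD hA); first exact: coord_Tdev_KL.
apply: (exponents_inN hA).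
set Y := X - _.
have DY y : E y -> D y Y = if y == z then 0 else D y X.
  move=> Ey; rewrite /Y linearB linearZ /= hD//.
  case: eqP => [->|_]; first by rewrite [_ *: _]mulr1 subrr.
  by rewrite scaler0 subr0.
rewrite (KL_expansion Y).
apply: (@fsum_closed _ _ (fun x => A_gt0 q (q (L s) * coord E Gam x z))).
- by rewrite coord0// mulr0.
- by move=> x x' hx hx'; rewrite coordD// mulrDr; apply: (exponents_inD hA).
move=> y Ey; rewrite DY// coordZ//; case: eqP => [|nyz].
  by rewrite mul0r mulr0.
have [Dy|nDy] := pselect (Des S J E y s); last by rewrite DX// mul0r mulr0.
have [zy|nzy] := pselect (Bruhat_le S z y); last first.
  by rewrite (KL_supp hC)// !mulr0.
have lzy : (len S z < len S y)%N.
  by apply: Bruhat_lt_len; split=> // e; apply: nyz.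
rewrite mulrA; apply: (A_gt0Ml hA hG); last exact: (KL_ge0 hC).
rewrite DX'//; apply: IH => //.
by rewrite -ltnS; apply: leq_trans lt; rewrite ltnS; apply: ltn_sub2l.
Qed.

(** * The action of T_s on the dual basis *)

Lemma dual_T_Asc s z : 0 < L s -> Asc S J E z s ->
  dual_act act (T s) (D z) = q (L s) *: D z.
Proof.
move=> Ls Az; have Ez := Asc_E Az.
apply: dual_eq_KL => w Ew /=.
rewrite /GRing.scale /= hD//.
have [Aw|Dw] := Asc_or_Des hW hJE (Asc_S Az) Ew.
  by rewrite dual_basis_T_Asc// (asboolF (Asc_notDes hJE Az)) addr0.
rewrite dual_basis_T_Des//; have /eqP/negbTE -> := Asc_Des_neq hJE Az Dw.
by rewrite !mulr0.
Qed.

(** Transpose of [dual_basis_T_Des] and [dual_basis_T_Asc]: the edge terms now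
    leave from z, which has s as a descent, and end at ascents. *)
Lemma dual_T_Des s z w : 0 < L s -> Des S J E z s -> E w ->
  dual_act act (T s) (D z) (C w) = - q (- L s) * D z (C w) +
    if `[< Asc S J E w s >] then dual_mu S m s w z else 0.
Proof.
move=> Ls Dz Ew; have Ez := Des_E Dz; rewrite /= hD//.
have [Aw|Dw] := Asc_or_Des hW hJE (Des_S Dz) Ew.
  rewrite dual_basis_T_Asc// (asboolT Dz) (asboolT Aw).
  have /nesym/eqP/negbTE -> := Asc_Des_neq hJE Aw Dz.
  by rewrite !mulr0.
by rewrite dual_basis_T_Des// asboolF ?addr0// => /(Asc_notDes hJE).
Qed.

Let above z s := [set u | [/\ E u, Bruhat_lt S z u & Asc S J E u s]].

Lemma scalar_add (f g : M -> A) :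
  scalar f -> scalar g -> scalar (fun x => f x + g x).
Proof. by move=> fL gL a x y; rewrite fL gL mulrDr addrACA. Qed.

Lemma scalar_mul c (f : M -> A) : scalar f -> scalar (fun x => c * f x).
Proof. by move=> fL a x y; rewrite fL mulrDr mulrCA. Qed.

Lemma scalar_dual (f : dual M) : scalar f.
Proof. by move=> a x y; rewrite linearP. Qed.

Lemma dual_mu_above s z w : E z -> E w -> Asc S J E w s -> w <> (s * z)%g ->
  dual_mu S m s w z = if `[< above z s w >] then m s z w else 0.
Proof.
move=> Ez Ew Aw /eqP/negbTE nw; rewrite /dual_mu nw.
congr (if _ then _ else _); apply: asbool_equiv_eq.
by split=> [|[]].
Qed.

Lemma dual_T_SD s z : 0 < L s -> SD S E z s -> forall x,
  dual_act act (T s) (D z) x = - q (- L s) * D z x + D (s * z)%g x +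
    \sum_(u \in above z s) m s z u * D u x.
Proof.
move=> Ls SDz; have aE : above z s `<=` E by move=> u [].
have SAsz := SD_mull hW SDz; have [Ss Ez lt Esz] := SDz.
apply: KL_ext.
- exact: scalar_dual.
- apply: scalar_add; last by move=> a x y; exact: dual_basis_sum_lin.
  by apply: scalar_add; [apply: scalar_mul|]; exact: scalar_dual.
move=> w Ew; rewrite (dual_T_Des Ls (or_introl SDz) Ew) -addrA; congr (_ + _).
rewrite hD// dual_basis_sum_KL//.
have [<-|/eqP/nesym nw] := eqVneq (s * z)%g w.
  rewrite (asboolT (or_introl SAsz : Asc S J E _ _)) /dual_mu eqxx.
  rewrite asboolF ?addr0// => -[_ /Bruhat_lt_len lt' _].
  by move: (ltn_trans lt lt'); rewrite ltnn.
rewrite add0r; case: asboolP => [Aw|nA]; first exact: dual_mu_above.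
by rewrite asboolF// => -[].
Qed.

Lemma dual_T_WD s z : 0 < L s -> WD S J E z s -> forall x,
  dual_act act (T s) (D z) x = - q (- L s) * D z x +
    \sum_(u \in above z s) m s z u * D u x.
Proof.
move=> Ls WDz; have aE : above z s `<=` E by move=> u [].
have nEsz := WD_mull hJE WDz; have [Ss Ez _ _] := WDz.
apply: KL_ext.
- exact: scalar_dual.
- apply: scalar_add; last by move=> a x y; exact: dual_basis_sum_lin.
  by apply: scalar_mul; exact: scalar_dual.
move=> w Ew; rewrite (dual_T_Des Ls (or_intror WDz) Ew); congr (_ + _).
rewrite dual_basis_sum_KL//; case: asboolP => [Aw|nA].
  by apply: dual_mu_above => // e; apply: nEsz; rewrite -e.
by rewrite asboolF// => -[].
Qed.

(** * The dual W-graph *)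
Section WgraphModule.
Context (hDb : is_basis E D).

(** The weights are the coordinates of T_s D_z in the basis D. *)
Lemma dual_mu_finite s z : 0 < L s -> Des S J E z s ->
  finite_set [set u | [/\ E u, Asc S J E u s & dual_mu S m s u z != 0]].
Proof.
move=> Ls Dz; pose f : dual M := dual_act act (T s) (D z).
apply: sub_finite_set (coord_finite hDb f) => u [Eu Au mu0] /=.
have <- : f (C u) = coord E D f u.
  rewrite {1}(coord_sum hDb f) (dual_sumE _ (coord_finite hDb f)).
    rewrite (fsum_delta Eu); first by rewrite /= hD// eqxx; exact: mulr1.
    by move=> w Ew /eqP/negbTE nw; rewrite /= hD// nw; exact: mulr0.
  by move=> w _ cw0; rewrite (coord_off cw0) scale0r.
rewrite dual_T_Des// (asboolT Au) hD//; last exact: Des_E Dz.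
have /nesym/eqP/negbTE -> := Asc_Des_neq hJE Au Dz.
by rewrite mulr0 add0r.
Qed.

Lemma dual_T_Des_sum s z : 0 < L s -> Des S J E z s ->
  dual_act act (T s) (D z) = - q (- L s) *: D z +
    \sum_(u \in [set u | E u /\ Asc S J E u s]) dual_mu S m s u z *: D u.
Proof.
move=> Ls Dz; pose U := [set u | E u /\ Asc S J E u s].
have UE : U `<=` E by move=> u [].
apply: dual_eq_KL => w Ew; rewrite dual_T_Des//.
rewrite [RHS]/= (dual_sumE _ (dual_mu_finite Ls Dz)); last first.
  move=> u [Eu Au] nu; have -> : dual_mu S m s u z = 0; last by rewrite scale0r.
  by apply/eqP/negPn/negP => mu0; apply: nu.
congr (_ + _); rewrite (dual_basis_sum_KL (fun u => dual_mu S m s u z) UE Ew).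
congr (if _ then _ else _); apply: asbool_equiv_eq.
by split=> [|[]].
Qed.

(** Transposition reverses products, and flip reverses them once more. *)
Definition dual_rep_fun (h : H) (f : dual M) : dual M :=
  dual_act act (flip T h) f.

Lemma dual_rep_linear h : linear (dual_rep_fun h).
Proof. by move=> a f g; apply: dual_ext. Qed.

HB.instance Definition _ h :=
  GRing.isLinear.Build A (dual M) (dual M) _ (dual_rep_fun h)
    (dual_rep_linear h).

Definition dual_rep (h : H) : {linear dual M -> dual M} := dual_rep_fun h.

Lemma dual_rep_Hmodule : is_Hmodule dual_rep.
Proof.
split=> [a h k f|f|h k f]; apply: dual_ext => x /=.
- by rewrite (flip_lin hH) act_lin linearP.
- by rewrite (flip1 hH) act1.
- by rewrite (flipM hW hH) actM.
Qed.

(** T_s^2 = 1 when L s = 0, so perm s is an involution of E and its transposed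
    permutation matrix is the matrix itself. *)
Lemma perm_dual perm s y : zero_weight_perm S L T E act C perm ->
  S s -> L s = 0 -> E y -> dual_act act (T s) (D y) = D (perm s y).
Proof.
move=> hperm Ss Ls Ey; have [[pE pI pS] pC] := hperm s Ss Ls.
have permE w : E w -> E (perm s w) by move=> Ew; apply: pE.
have permK w : E w -> perm s (perm s w) = w.
  move=> Ew; have e : C (perm s (perm s w)) = C w.
    rewrite -!pC//; last exact: permE.
    rewrite -actM (T_sq hW hH Ss) Ls oppr0 subrr scale0r addr0.
    exact: act1.
  have /(congr1 (D w)) := e; rewrite !hD//; last exact/permE/permE.
  rewrite eqxx; case: eqVneq => // _ /esym /eqP.
  by rewrite oner_eq0.
apply: dual_eq_KL => w Ew /=; rewrite pC// !hD//; try exact: permE.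
congr (_%:R); congr nat_of_bool; apply/eqP/eqP => [->|<-]; rewrite permK//.
Qed.

Lemma dual_Wgraph perm : zero_weight_perm S L T E act C perm ->
  is_Wgraph_module q S L T Mirror (fun s => dual_act act (T s))
    E D (Asc S J E) (dual_mu S m) perm.
Proof.
move=> hperm; split=> //.
- by move=> x _ s /Asc_S.
- move=> s x y Ss Ls Ex Ey Ax nAy; have Dy := notAsc_Des hW hJE Ss Ey nAy.
  by split; [exact: dual_mu_gt0|exact: dual_mu_bar].
- move=> s y Ss Ls Ey nAy; have Dy := notAsc_Des hW hJE Ss Ey nAy.
  exact: dual_mu_finite.
- by move=> s Ss Ls; case: (hperm s Ss Ls).
- exists dual_rep; split; first exact: dual_rep_Hmodule.
  move=> s f Ss; apply: dual_ext => x.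
  by rewrite /= /dual_rep_fun (flip_gens hW hH).
- by move=> s y Ss Ls Ey; apply: perm_dual.
- by move=> s y Ss Ls Ey Ay; apply: dual_T_Asc.
- move=> s y Ss Ls Ey nAy; have Dy := notAsc_Des hW hJE Ss Ey nAy.
  exact: dual_T_Des_sum.
Qed.

End WgraphModule.

End WgraphCoefs.
End DualBasis.
End WgraphIdeal.

Theorem theorem4p4
  (W : groupType) (S : set W) (hW : Coxeter_system S)
  (G : porderZmodType) (hG : totally_ordered_group G)
  (L : W -> G) (hL : weight_function S L) (hL0 : forall s, S s -> 0 <= L s)
  (K : realType) (P : {pred K[i]}) (R : subComNzRingType P)
  (A : comAlgType R) (q : G -> A) (hA : is_group_algebra q)
  (H : unitAlgType A) (T : W -> H) (hH : is_Hecke_algebra q S L T)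
  (J E : set W) (M : lmodType A) (act : H -> {linear M -> M})
  (Gam : W -> M) (barM : M -> M)
  (hE : is_Wgraph_ideal q S L T J E act Gam barM)
  (C : W -> M) (hC : is_KL_basis q S E Gam barM C)
  (m : W -> W -> W -> A) (hm : are_W_graph_coefs q S L T J E act C m)
  (D : W -> dual M)
  (hD : forall z w, E z -> E w -> D z (C w) = (z == w)%:R) :
  (* If E is infinite the sums have finite support only at each x : M. *)
  (forall s, S s -> 0 < L s -> forall z, E z ->
     [/\ SD S E z s -> forall x,
           dual_act act (T s) (D z) x =
             - q (- L s) * D z x + D (s * z)%g x +
             \sum_(u \in [set u | [/\ E u, Bruhat_lt S z u
                                    & Asc S J E u s]]) m s z u * D u x,
         Asc S J E z s ->
           dual_act act (T s) (D z) = q (L s) *: D z &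
         WD S J E z s -> forall x,
           dual_act act (T s) (D z) x =
             - q (- L s) * D z x +
             \sum_(u \in [set u | [/\ E u, Bruhat_lt S z u
                                    & Asc S J E u s]]) m s z u * D u x]) /\
  (finite_set E -> is_basis E D) /\
  (is_basis E D -> forall perm, zero_weight_perm S L T E act C perm ->
     is_Wgraph_module q S L T Mirror (fun s => dual_act act (T s))
       E D (Asc S J E) (dual_mu S m) perm).
Proof.
split; [move=> s Ss Ls z Ez; split|split].
- exact: (dual_T_SD hW hE hC hD hm Ls).
- exact: (dual_T_Asc hW hE hC hD hm Ls).
- exact: (dual_T_WD hW hE hC hD hm Ls).
- exact: (dual_basis_finite_basis hE hC hD).
move=> hDb perm.
exact: (dual_Wgraph hW hG hA hH hE hC hD hm hDb).
Qed.
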